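(* Let $S=\mathbb{R}/\mathbb{Z}$ be the circle, with points represented by $t\in[0,1)$, and let $r(s,t)=\min(|s-t|,1-|s-t|)$ be the circular distance. Let $\{B(t):t\in S\}$ be a centered real Gaussian process with covariance function $$\operatorname{cov}(B(t),B(s))=\tfrac12\big(r(0,t)+r(0,s)-r(s,t)\big),\qquad s,t\in S.$$ Then: (i) for all $s,t\in[0,1/2]$, $\operatorname{cov}(B(t),B(s))=\min(s,t)$, i.e. on $[0,1/2]$ the process $B$ is (in covariance) a standard one-dimensional Euclidean Brownian motion; (ii) for every $s\in(1/2,1)$, $B(s)=B(0)+B(1/2)-B(s-1/2)$ almost surely.
   Context: The process $B$ is Lévy's Brownian motion on the circle $S=\mathbb{R}/\mathbb{Z}$ (circumference $1$), with the pre-chosen base point $o$ taken to be $0$. *)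

(* Defs.v *)
From HB Require Import structures.
From mathcomp Require Import all_boot all_order all_algebra.
From mathcomp Require Import all_classical all_reals all_analysis.

Set Implicit Arguments.
Unset Strict Implicit.
Unset Printing Implicit Defensive.

Import Order.TTheory GRing.Theory Num.Theory.

Local Open Scope classical_set_scope.
Local Open Scope ring_scope.

(* R/Z, each class being represented by its element of [0, 1). *)
Definition circle (R : realType) : Type := {t : R | 0 <= t < 1}.

Lemma fract_bounds (R : realType) (t : R) : 0 <= t - (Num.floor t)%:~R < 1.
Proof.
by rewrite subr_ge0 ltrBlDl -intrD1 floor_itv.
Qed.

(* The projection R -> R/Z. *)
Definition circle_of (R : realType) (t : R) : circle R :=
  exist _ (t - (Num.floor t)%:~R) (fract_bounds t).

Lemma circle_ofK (R : realType) (t : R) : 0 <= t < 1 -> sval (circle_of t) = t.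
Proof.
move=> /andP[t0 t1] /=.
by rewrite (@floor_def _ t 0) ?mulr0z ?subr0// t0 add0r.
Qed.

Definition circle_dist (R : realType) (s t : circle R) : R :=
  Num.min `|sval s - sval t| (1 - `|sval s - sval t|).

(* Degenerate laws are Gaussian.  They have to be listed apart, since
   [normal_prob m 0] is the uniform law on [0, 1] and not [\d_m]. *)
Definition gaussian_rv d (T : measurableType d) (R : realType)
    (P : probability T R) (f : T -> R) : Prop :=
  (exists m : R, forall A : set R, measurable A ->
     pushforward P f A = \d_m A) \/
  (exists m sigma : R, 0 < sigma /\ forall A : set R, measurable A ->
     pushforward P f A = normal_prob m sigma A).

(* All finite-dimensional marginals are jointly (possibly degenerate)
   Gaussian, that is, all finite linear combinations are Gaussian. *)
Definition gaussian_process d (T : measurableType d) (R : realType)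
    (P : probability T R) (I : Type) (X : I -> {RV P >-> R}) : Prop :=
  forall (n : nat) (t : 'I_n -> I) (a : 'I_n -> R),
    gaussian_rv P (fun w => \sum_(i < n) a i * X (t i) w).

Definition centered_process d (T : measurableType d) (R : realType)
    (P : probability T R) (I : Type) (X : I -> {RV P >-> R}) : Prop :=
  forall t : I, ('E_P[X t] = 0)%E.

(* Main.v *)
Require Import Defs.
From mathcomp Require Import all_boot all_order all_algebra.
From mathcomp Require Import all_classical all_reals all_analysis.
From mathcomp Require Import measurable_realfun lra.

Import Order.TTheory GRing.Theory Num.Theory.

Local Open Scope classical_set_scope.
Local Open Scope ring_scope.

(** Part (i) is a computation: two points of [0, 1/2] are at circular distance
    at most 1/2, so the distance is |s - t|, and (s + t - |s - t|) / 2 is the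
    minimum of s and t.

    Part (ii) rests on the geometry of antipodal points: the distances from any
    x to u and to u + 1/2 add up to 1/2 ([circle_dist_antipodal]).  In the
    covariance of B(x) with B(u) + B(u + 1/2), these sums occur twice with
    opposite signs, once seen from 0 and once seen from x, and cancel; what
    remains is r(0, x), whatever the pair ([covariance_antipodal]).  Therefore
    the difference Z of the sums of B over two antipodal pairs is uncorrelated
    with every B(x).  As Z is itself a linear combination of such values, its
    variance vanishes, and a centered variable with zero variance vanishes
    almost surely ([variance0_ae]).  The theorem is the comparison of the pair
    {s - 1/2, s} with the pair {0, 1/2}.

    The bilinearity of the covariance is available for square-integrable
    variables; square integrability holds because the prescribed variances are
    finite ([variance_lty_Lfun2]). *)

Section finite_variance.
Context {d : measure_display} {T : measurableType d} {R : realType}.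
Variable P : probability T R.

(** The variance is the integral of (X - c)^2, where c is the finite part of
    the expectation of X.  Whatever the real number c, finiteness of this
    integral puts X - c in L^2, and constants are in L^2 as well. *)
Lemma variance_lty_Lfun2 (X : {RV P >-> R}) :
  (variance P X < +oo)%E -> (X : T -> R) \in Lfun P 2%:E.
Proof.
rewrite /variance unlock; set c := fine _; rewrite unlock => VX.
have mY : measurable_fun [set: T] (X \- cst c).
  exact: measurable_funB.
suff Y2 : X \- cst c \in Lfun P 2%:E.
  have -> : (X : T -> R) = (X \- cst c) + cst c.
    by apply/funext => w; rewrite !fctE /= subrK.
  by rewrite rpredD ?lee1n//= Lfun_cst.
rewrite inE; apply/andP; split; first by rewrite inE.
rewrite inE /= /finite_norm unlock /=.
rewrite poweR_lty//; apply: le_lt_trans VX.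
under eq_integral => w _ do
  rewrite /= powR_mulrn// -normrX ger0_norm ?sqr_ge0// expr2.
by [].
Qed.

Lemma variance0_ae (X : T -> R) :
  measurable_fun [set: T] X -> variance P X = 0%E ->
  {ae P, forall w, X w = fine 'E_P[X]}.
Proof.
move=> mX; rewrite /variance unlock; set c := fine _; rewrite unlock => VX.
have mY : measurable_fun [set: T] (X \- cst c) by exact: measurable_funB.
pose Y2 : T -> \bar R := EFin \o ((X \- cst c) * (X \- cst c)).
have mY2 : measurable_fun [set: T] Y2.
  by apply/measurable_EFinP; exact: measurable_funM.
have [+ _] := ae_eq_integral_abs P measurableT mY2.
have -> : (\int[P]_w `|Y2 w| = 0)%E.
  rewrite -[RHS]VX; apply: eq_integral => w _.
  by rewrite gee0_abs// lee_fin -expr2 sqr_ge0.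
move=> /(_ erefl); apply: filterS => w /(_ I) [] /eqP.
by rewrite mulf_eq0 orbb /= subr_eq0 => /eqP.
Qed.

End finite_variance.

Section circle_distance.
Context {R : realType}.
Implicit Types (u : R) (x y : circle R).

Lemma circle_distC x y : circle_dist x y = circle_dist y x.
Proof. by rewrite /circle_dist distrC. Qed.

Lemma circle_dist_le_half (s t : R) :
    0 <= s <= 2^-1 -> 0 <= t <= 2^-1 ->
  circle_dist (circle_of s) (circle_of t) = `|s - t|.
Proof.
move=> /andP[s0 s1] /andP[t0 t1].
rewrite /circle_dist !circle_ofK; try (apply/andP; split; lra).
by rewrite min_l//; case: (ler0P (s - t)) => st; lra.
Qed.

(** A half-turn starting at u and ending at u + 1/2 passes through x,
    in one of the two directions. *)
Lemma circle_dist_antipodal x u : 0 <= u < 2^-1 ->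
  circle_dist (circle_of u) x + circle_dist (circle_of (u + 2^-1)) x = 2^-1.
Proof.
case: x => x x01 /andP[u0 u1]; have /andP[x0 x1] := x01.
rewrite /circle_dist !circle_ofK; try (apply/andP; split; lra).
rewrite /=; case: (ler0P (u - x)) => ux; case: (ler0P (u + 2^-1 - x)) => vx;
  case: leP => h1; case: leP => h2; lra.
Qed.

End circle_distance.

Section levy_brownian_circle.
Context {d : measure_display} {T : measurableType d} {R : realType}.
Variables (P : probability T R) (B : circle R -> {RV P >-> R}).
Hypothesis B_cov : forall s t : circle R,
  covariance P (B t) (B s) =
    (2^-1 * (circle_dist (circle_of 0) t + circle_dist (circle_of 0) s
             - circle_dist s t))%:E.

Lemma levy_Lfun2 x : (B x : T -> R) \in Lfun P 2%:E.
Proof. by apply: variance_lty_Lfun2; rewrite /variance B_cov ltry. Qed.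

Definition antipodal_sum u : T -> R :=
  B (circle_of u) \+ B (circle_of (u + 2^-1)).

Lemma antipodal_sum_Lfun2 u : antipodal_sum u \in Lfun P 2%:E.
Proof. by rewrite rpredD ?lee1n//= levy_Lfun2. Qed.

(** Twice the left-hand side is 2 r(0, x) plus the distances from 0 to the pair,
    minus the distances from x to the pair; each of the last two sums is 1/2. *)
Lemma covariance_antipodal x u : 0 <= u < 2^-1 ->
  covariance P (B x) (antipodal_sum u) = (circle_dist (circle_of 0) x)%:E.
Proof.
move=> u01; rewrite covarianceDr ?levy_Lfun2// !B_cov -EFinD; congr EFin.
have := circle_dist_antipodal x _ u01.
have := circle_dist_antipodal (circle_of 0) _ u01.
rewrite !(circle_distC _ (circle_of 0)); lra.
Qed.

(** Write Z for the difference.  Every B(x) is uncorrelated with Z, by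
    [covariance_antipodal]; so is Z itself, being a combination of them. *)
Lemma variance_antipodal_sumB u v : 0 <= u < 2^-1 -> 0 <= v < 2^-1 ->
  variance P (antipodal_sum u \- antipodal_sum v) = 0%E.
Proof.
move=> u01 v01; set Z := _ \- _.
have Z2 : Z \in Lfun P 2%:E by rewrite rpredB ?lee1n//= antipodal_sum_Lfun2.
have BZ x : covariance P (B x) Z = 0%E.
  rewrite covarianceBr ?levy_Lfun2 ?antipodal_sum_Lfun2//.
  by rewrite !covariance_antipodal// -EFinB subrr.
have SZ w : covariance P (antipodal_sum w) Z = 0%E.
  by rewrite covarianceDl ?levy_Lfun2// !BZ adde0.
by rewrite /variance {1}/Z covarianceBl ?antipodal_sum_Lfun2// !SZ sube0.
Qed.

(** Both sums have expectation 0, so the almost sure constant value of their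
    difference is 0. *)
Lemma antipodal_sum_ae u v : centered_process B ->
    0 <= u < 2^-1 -> 0 <= v < 2^-1 ->
  {ae P, forall w, antipodal_sum u w = antipodal_sum v w}.
Proof.
move=> B0 u01 v01.
have B1 x : (B x : T -> R) \in Lfun P 1.
  by rewrite Lfun_subset12 ?levy_Lfun2 ?fin_num_measure.
have S1 w : antipodal_sum w \in Lfun P 1 by rewrite rpredD/=.
have E0 : ('E_P[antipodal_sum u \- antipodal_sum v] = 0)%E.
  rewrite expectationB// !expectationD//.
  by rewrite !B0 !adde0 sube0.
have mS w : measurable_fun [set: T] (antipodal_sum w).
  exact: measurable_funD.
have := variance0_ae P _ (measurable_funB (mS u) (mS v))
  (variance_antipodal_sumB _ _ u01 v01).
by rewrite E0; apply: filterS => w /= /eqP; rewrite subr_eq0 => /eqP.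
Qed.

End levy_brownian_circle.

Theorem mainTheorem1 (d : measure_display) (T : measurableType d)
    (R : realType) (P : probability T R) (B : circle R -> {RV P >-> R})
    (B_gaussian : gaussian_process B)
    (B_centered : centered_process B)
    (B_cov : forall s t : circle R,
      covariance P (B t) (B s) =
        (2^-1 * (circle_dist (circle_of 0) t + circle_dist (circle_of 0) s
                 - circle_dist s t))%:E) :
  (forall s t : R, 0 <= s <= 2^-1 -> 0 <= t <= 2^-1 ->
     covariance P (B (circle_of t)) (B (circle_of s)) = (Num.min s t)%:E)
  /\
  (forall s : R, 2^-1 < s < 1 ->
     {ae P, forall w, B (circle_of s) w =
        B (circle_of 0) w + B (circle_of (2^-1)) w
        - B (circle_of (s - 2^-1)) w}).
Proof.
split=> [s t s01 t01|s /andP[s1 s2]].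
  have z01 : 0 <= (0 : R) <= 2^-1 by apply/andP; split; lra.
  rewrite B_cov !circle_dist_le_half//; congr EFin.
  move: s01 t01 => /andP[s0 _] /andP[t0 _].
  rewrite !sub0r !normrN (ger0_norm s0) (ger0_norm t0).
  by case: (leP s t) => st; case: (ler0P (s - t)) => st'; lra.
have u01 : 0 <= s - 2^-1 < 2^-1 by apply/andP; split; lra.
have z01 : 0 <= (0 : R) < 2^-1 by apply/andP; split; lra.
have := antipodal_sum_ae _ _ B_cov _ _ B_centered u01 z01.
apply: filterS => w; rewrite /antipodal_sum subrK add0r /= => <-.
by rewrite addrC addKr.
Qed.
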